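(* Let $A$ be a Prüfer $v$-multiplication domain with torsion class group (for example, a GCD domain). Then $A$ is globally perinormal.
   Context: All rings are commutative unitary integral domains. An overring of a domain $A$ is a ring $B$ between $A$ and the quotient field $K$ of $A$. An overring $B$ of $A$ is a going down overring if going down holds for $A\subseteq B$, that is, for each $Q\in\mathrm{Spec}(B)$ the induced map $\mathrm{Spec}(B_Q)\to\mathrm{Spec}(A_{Q\cap A})$ is surjective. $A$ is globally perinormal if every going down overring of $A$ is a fraction ring of $A$, i.e. of the form $S^{-1}A$ for a multiplicative set $S\subseteq A\setminus\{0\}$. For a nonzero fractional ideal $H$ of $A$, put $H^{-1}=\{x\in K\mid xH\subseteq A\}$ and $H_v=(H^{-1})^{-1}$. $A$ is a Prüfer $v$-multiplication domain (PVMD) if for every finitely generated nonzero ideal $I$ of $A$ there exists a finitely generated nonzero ideal $J$ of $A$ such that $(IJ)_v$ is a principal ideal. If $A$ is a PVMD, the set $D(A)=\{H_v\mid H \text{ a finitely generated nonzero fractional ideal of } A\}$ is a group under the operation $(H_1,H_2)\mapsto (H_1H_2)_v$, and the class group $Cl(A)$ is the quotient of $D(A)$ by the subgroup of all principal nonzero fractional ideals. A GCD domain is a domain in which any two nonzero elements have a greatest common divisor; the GCD domains are exactly the PVMDs with zero class group. *)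

(* Defs.v *)
From mathcomp Require Import all_boot all_order all_algebra.
From mathcomp Require Import boolp classical_sets functions cardinality.

Set Implicit Arguments.
Unset Strict Implicit.
Unset Printing Implicit Defensive.

Import GRing.Theory.
Local Open Scope classical_set_scope.
Local Open Scope ring_scope.

(* A domain A and all its overrings, localizations and fractional ideals are
   handled as subsets of the quotient field K of A; A itself is the image of
   the embedding [tofrac] of A into [{fraction A}]. *)

Definition base_ring (A : idomainType) : set {fraction A} :=
  range (@tofrac A).
Arguments base_ring A _ : clear implicits.

Section SubsetsOfField.
Variable K : fieldType.
Implicit Types R B S P Q H I J X : set K.

(* In this section R is a subring of K, and K is meant to be its quotient
   field. *)

Definition submodule R H : Prop :=
  GRing.zmod_closed (mem H) /\ (forall r h, R r -> H h -> H (r * h)).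

Definition ideal R I : Prop := I `<=` R /\ submodule R I.

Definition Spec R : set (set K) :=
  [set P | [/\ ideal R P, ~ P 1 &
    forall x y, R x -> R y -> P (x * y) -> P x \/ P y]].

Definition fraction_ring R S : set K := [set a / s | a in R & s in S].

Definition localization R P : set K := fraction_ring R (R `\` P).

Definition overring R B : Prop :=
  R `<=` B /\ GRing.subring_closed (mem B).

Definition going_down R B : Prop :=
  forall Q, Spec B Q ->
    let RQ := localization R (Q `&` R) in
    set_surj (Spec (localization B Q)) (Spec RQ) (fun P => P `&` RQ).

Definition globally_perinormal R : Prop :=
  forall B, overring R B -> going_down R B ->
    exists S, [/\ S `<=` R `\ 0, GRing.mulr_closed (mem S) &
                  B = fraction_ring R S].

Definition span R X : set K := smallest (submodule R) X.

Definition finitely_generated R H : Prop :=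
  exists2 X, finite_set X & H = span R X.

Definition fractional_ideal R H : Prop :=
  submodule R H /\
  exists d, [/\ R d, d != 0 & forall h, H h -> R (d * h)].

Definition ideal_mul R I J : set K := span R [set x * y | x in I & y in J].

Definition ideal_inv R H : set K :=
  [set x | forall h, H h -> R (x * h)].

Definition v_closure R H : set K := ideal_inv R (ideal_inv R H).

Definition principal R (x : K) : set K := [set x * r | r in R].

Definition fg_nonzero_ideal R I : Prop :=
  [/\ ideal R I, finitely_generated R I & I <> [set 0]].

Definition PVMD R : Prop :=
  forall I, fg_nonzero_ideal R I ->
    exists2 J, fg_nonzero_ideal R J &
      exists2 d, R d & v_closure R (ideal_mul R I J) = principal R d.

Definition fg_nonzero_fractional_ideal R H : Prop :=
  [/\ fractional_ideal R H, finitely_generated R H & H <> [set 0]].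

(* The underlying set of the group D(R), and its operation. *)
Definition vdiv R : set (set K) :=
  [set v_closure R H | H in fg_nonzero_fractional_ideal R].

Definition vdiv_mul R H1 H2 : set K := v_closure R (ideal_mul R H1 H2).

Definition principal_fractional_ideals R : set (set K) :=
  [set principal R x | x in [set x : K | x != 0]].

(* The class group is the quotient of D(R) by its subgroup of principal
   fractional ideals: its elements are the cosets of this subgroup, multiplied
   elementwise, and its identity is the subgroup itself.  This is a group when
   R is a PVMD. *)
Definition Cl R : set (set (set K)) :=
  [set [set vdiv_mul R H P | P in principal_fractional_ideals R]
     | H in vdiv R].

Definition Cl_mul R (c1 c2 : set (set K)) : set (set K) :=
  [set vdiv_mul R H1 H2 | H1 in c1 & H2 in c2].

Definition Cl_exp R (c : set (set K)) (n : nat) : set (set K) :=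
  iter n (Cl_mul R c) (principal_fractional_ideals R).

Definition torsion_class_group R : Prop :=
  forall c, Cl R c ->
    exists2 n, (0 < n)%N & Cl_exp R c n = principal_fractional_ideals R.

End SubsetsOfField.

Definition divides (A : idomainType) (a b : A) : Prop := exists q, b = q * a.

Definition GCD_domain (A : idomainType) : Prop :=
  forall a b : A, a != 0 -> b != 0 ->
    exists d, [/\ divides d a, divides d b &
      forall c, divides c a -> divides c b -> divides c d].

(* Main.v *)
(* Let [x = a / b] lie in a going down overring [B] of [R].  In a PVMD,
   [(a ^ n, b ^ n)_v = ((a, b) ^ n)_v], which torsion makes principal for some
   [n > 0]; dividing out its generator gives [x ^ n = a' / b'] with
   [(a', b')_v = R].  If [b'] lay in a prime [Q] of [B], let [P = Q ∩ R].  Going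
   down lifts each prime of [R_P] containing [b'] to one of [B_Q], which contains
   [a' = b' x ^ n]; so [a'] is in the radical of [b' R_P], that is
   [a' ^ k t = b' c] with [t] in [R \ P], and coprimality forces [b'] to divide
   [t], which is absurd.  So [b'] is a unit of [B], and [b' x] is in [R] because
   [R] is root closed. *)
Require Import Defs.
From mathcomp Require Import all_boot all_order all_algebra.
From mathcomp Require Import boolp classical_sets functions cardinality.
From mathcomp Require Import ring.

Set Implicit Arguments.
Unset Strict Implicit.
Unset Printing Implicit Defensive.

Import GRing.Theory Defs.
Local Open Scope classical_set_scope.
Local Open Scope ring_scope.

(** * Closure conditions restated as membership in sets *)

Section SetsClosedUnderOperations.
Variable K : fieldType.
Implicit Types (R H : set K).

Lemma zmod_closedP H : GRing.zmod_closed (mem H) <->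
  H 0 /\ (forall x y, H x -> H y -> H (x - y)).
Proof.
split=> [[h0 hB]|[h0 hB]]; split.
- exact: set_mem h0.
- by move=> x y hx hy; apply: set_mem; apply: hB; apply: mem_set.
- exact: mem_set.
- by move=> x y /set_mem hx /set_mem hy; apply: mem_set; apply: hB.
Qed.

Lemma mulr_closedP R : GRing.mulr_closed (mem R) <->
  R 1 /\ (forall x y, R x -> R y -> R (x * y)).
Proof.
split=> [[h1 hM]|[h1 hM]]; split.
- exact: set_mem h1.
- by move=> x y hx hy; apply: set_mem; apply: hM; apply: mem_set.
- exact: mem_set.
- by move=> x y /set_mem hx /set_mem hy; apply: mem_set; apply: hM.
Qed.

Lemma subring_closedP R : GRing.subring_closed (mem R) <->
  [/\ R 1, (forall x y, R x -> R y -> R (x - y)) &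
      (forall x y, R x -> R y -> R (x * y))].
Proof.
split=> [[h1 hB hM]|[h1 hB hM]]; split.
- exact: set_mem h1.
- by move=> x y hx hy; apply: set_mem; apply: hB; apply: mem_set.
- by move=> x y hx hy; apply: set_mem; apply: hM; apply: mem_set.
- exact: mem_set.
- by move=> x y /set_mem hx /set_mem hy; apply: mem_set; apply: hB.
- by move=> x y /set_mem hx /set_mem hy; apply: mem_set; apply: hM.
Qed.

End SetsClosedUnderOperations.

(** * Submodules, principal ideals and spans over a subring *)

Section Subring.
Variables (K : fieldType) (R : set K).
Hypothesis ringR : GRing.subring_closed (mem R).
Implicit Types (H I J X P S : set K) (x y z a b d : K).

Lemma subring1 : R 1.
Proof. by case/subring_closedP: ringR. Qed.

Lemma subringB x y : R x -> R y -> R (x - y).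
Proof. by case/subring_closedP: ringR => _ h _; apply: h. Qed.

Lemma subringM x y : R x -> R y -> R (x * y).
Proof. by case/subring_closedP: ringR => _ _ h; apply: h. Qed.

Lemma subring0 : R 0.
Proof. by rewrite -(subrr 1); apply: subringB; apply: subring1. Qed.

Lemma subringX x n : R x -> R (x ^+ n).
Proof.
move=> hx; elim: n => [|n IH]; first exact: subring1.
by rewrite exprS; apply: subringM.
Qed.

Lemma submodule0 H : submodule R H -> H 0.
Proof. by case=> /zmod_closedP[]. Qed.

Lemma submoduleB H x y : submodule R H -> H x -> H y -> H (x - y).
Proof. by case=> /zmod_closedP[_ h] _; apply: h. Qed.

Lemma submoduleD H x y : submodule R H -> H x -> H y -> H (x + y).
Proof.
move=> hH hx hy; have -> : x + y = x - (0 - y) by ring.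
apply: submoduleB => //.
by apply: submoduleB => //; apply: submodule0.
Qed.

Lemma submoduleM H r x : submodule R H -> R r -> H x -> H (r * x).
Proof. by case=> _ h; apply: h. Qed.

Lemma ideal_subring : ideal R R.
Proof.
split=> //; split; last exact: subringM.
by apply/zmod_closedP; split; [exact: subring0|exact: subringB].
Qed.

Lemma principal_submodule d : submodule R (principal R d).
Proof.
split; first (apply/zmod_closedP; split).
- by exists 0; [exact: subring0|rewrite mulr0].
- move=> _ _ [r hr <-] [s hs <-]; exists (r - s); first exact: subringB.
  by rewrite mulrBr.
- move=> r _ hr [s hs <-]; exists (r * s); first exact: subringM.
  by rewrite mulrCA.
Qed.

Lemma principal_ideal d : R d -> ideal R (principal R d).
Proof.
move=> hd; split; last exact: principal_submodule.
by move=> _ [r hr <-]; apply: subringM.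
Qed.

Lemma principal_self d : principal R d d.
Proof. by exists 1; [exact: subring1|rewrite mulr1]. Qed.

Lemma principalP d y : d != 0 -> principal R d y <-> R (y / d).
Proof.
move=> d0; split=> [[r hr <-]|hy]; first by rewrite mulrC mulKf.
by exists (y / d) => //; rewrite mulrC divfK.
Qed.

Lemma span_submodule X : submodule R (span R X).
Proof.
split; first (apply/zmod_closedP; split).
- by move=> M [hM _]; apply: submodule0.
- move=> x y hx hy M hM; apply: submoduleB; first by case: hM.
    exact: hx.
  exact: hy.
- move=> r x hr hx M hM; apply: submoduleM => //; first by case: hM.
  exact: hx.
Qed.

Lemma sub_span X : X `<=` span R X.
Proof. exact: sub_gen_smallest. Qed.

Lemma span_sub X H : submodule R H -> X `<=` H -> span R X `<=` H.
Proof. exact: smallest_sub. Qed.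

Lemma span_ideal X : X `<=` R -> ideal R (span R X).
Proof.
move=> hX; split; last exact: span_submodule.
by apply: span_sub => //; case: ideal_subring.
Qed.

(** * Inverses and v-closures *)

Lemma ideal_invS X H : X `<=` H -> ideal_inv R H `<=` ideal_inv R X.
Proof. by move=> h y hy x /h; apply: hy. Qed.

Lemma sub_v_closure X : X `<=` v_closure R X.
Proof. by move=> x hx y hy; rewrite mulrC; apply: hy. Qed.

Lemma ideal_inv_v_closure X : ideal_inv R (v_closure R X) = ideal_inv R X.
Proof.
apply/seteqP; split; first exact/ideal_invS/sub_v_closure.
by move=> y hy h hh; rewrite mulrC; apply: hh.
Qed.

(** The elements that [y] multiplies into [R] form a submodule, so inverses can be tested on
    generators. *)
Lemma ideal_inv_span X : ideal_inv R (span R X) = ideal_inv R X.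
Proof.
apply/seteqP; split; first by apply: ideal_invS; apply: sub_span.
move=> y hy h; apply: (@span_sub X [set h | R (y * h)]) => //.
split; first (apply/zmod_closedP; split) => /=.
- by rewrite mulr0; apply: subring0.
- by move=> a b ha hb; rewrite mulrBr; apply: subringB.
- by move=> r a hr ha; rewrite /= mulrCA; apply: subringM.
Qed.

Lemma ideal_inv_mul I J y : ideal_inv R (ideal_mul R I J) y <->
  forall a b, I a -> J b -> R (y * (a * b)).
Proof.
rewrite ideal_inv_span; split=> [h a b ha hb|h _ [a ha [b hb <-]]].
  by apply: h; exists a => //; exists b.
exact: h.
Qed.

Lemma ideal_inv_vdiv_mul I J y : ideal_inv R (vdiv_mul R I J) y <->
  forall a b, I a -> J b -> R (y * (a * b)).
Proof. by rewrite ideal_inv_v_closure; apply: ideal_inv_mul. Qed.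

Lemma ideal_inv_principal d y : ideal_inv R (principal R d) y <-> R (y * d).
Proof.
split=> [h|h _ [r hr <-]]; first exact/h/principal_self.
by rewrite mulrA; apply: subringM.
Qed.

(** By hypothesis [X] and [principal R d] have the same inverse, hence the same v-closure. This
    reduces later computations of v-closures to inverses. *)
Lemma v_closure_principal X d : d != 0 ->
  (forall y, ideal_inv R X y <-> R (y * d)) -> v_closure R X = principal R d.
Proof.
move=> d0 hX; apply/seteqP; split=> x.
  move=> hx; apply/principalP => //; apply: hx.
  by apply/hX; rewrite mulVf //; exact: subring1.
move=> /principalP-/(_ d0) hx y /hX hy.
have -> : x * y = (x / d) * (y * d) by field.
exact: subringM.
Qed.

(* Equivalent to [((a, b) (a, b)^-1)_v = R]. *)
Definition v_invertible_pair a b : Prop :=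
  forall z, (forall j, R (a * j) -> R (b * j) ->
    R (z * (a * j)) /\ R (z * (b * j))) -> R z.

(* With [I = (a, b)], one has [I ^ (2n - 1) = (a ^ n, b ^ n) I ^ (n - 1)], so
   [y] multiplies the left side into [I ^ (n - 1)]; then cancel [n - 1] factors
   [I] one by one. Here [p] ranges over the inverse of [I ^ k]. *)
Lemma monomials_in_subring a b n y : v_invertible_pair a b ->
  R (y * a ^+ n) -> R (y * b ^+ n) ->
  forall i l, (i + l = n)%N -> R (y * (a ^+ i * b ^+ l)).
Proof.
move=> hab ha hb.
suff main m : forall k p, (k + m = n.-1)%N ->
    (forall i l, (i + l = k)%N -> R (a ^+ i * b ^+ l * p)) ->
    forall i l, (i + l = n + k)%N -> R (y * (a ^+ i * b ^+ l) * p).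
  move=> i l il; rewrite -[y * _]mulr1; apply: (main n.-1 0) => //.
  - move=> i' l' /eqP; rewrite addn_eq0 => /andP[/eqP-> /eqP->].
    by rewrite !expr0 !mulr1; apply: subring1.
  - by rewrite addn0.
elim: m => [|m IH] k p km hp i l il.
  (* Here [k = n.-1], so [i + l = n + k] forces [n <= i] or [n <= l]. *)
  have [le_ni|lt_in] := leqP n i.
    have -> : y * (a ^+ i * b ^+ l) * p =
        (y * a ^+ n) * (a ^+ (i - n) * b ^+ l * p).
      by rewrite -{1}(subnKC le_ni) exprD; ring.
    apply: subringM => //; apply: hp.
    by apply/eqP; rewrite -(eqn_add2l n) addnA subnKC // il.
  have le_nl : (n <= l)%N.
    rewrite -(leq_add2l i) il addnC leq_add2l; move: km lt_in.
    by rewrite addn0 => ->; case: (n).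
  have -> : y * (a ^+ i * b ^+ l) * p =
      (y * b ^+ n) * (a ^+ i * b ^+ (l - n) * p).
    by rewrite -{1}(subnKC le_nl) exprD; ring.
  apply: subringM => //; apply: hp.
  by apply/eqP; rewrite -(eqn_add2l n) addnCA subnKC // il.
(* One factor is cancelled by testing against [j] in the inverse of [(a, b)]: multiplying by [a * j]
   or [b * j] raises the degree by one and turns [p] into [p * j], which is in the inverse of the
   next power. *)
apply: hab => j haj hbj.
have hpj i' l' : (i' + l' = k.+1)%N -> R (a ^+ i' * b ^+ l' * (p * j)).
  case: i' => [|i'].
    rewrite add0n => ->.
    have -> : a ^+ 0 * b ^+ k.+1 * (p * j) =
      (b * j) * (a ^+ 0 * b ^+ k * p) by rewrite exprS; ring.
    by apply: subringM => //; apply: hp.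
  rewrite addSn => -[il'].
  have -> : a ^+ i'.+1 * b ^+ l' * (p * j) =
    (a * j) * (a ^+ i' * b ^+ l' * p) by rewrite exprS; ring.
  by apply: subringM => //; apply: hp.
have kmS : (k.+1 + m = n.-1)%N by rewrite addSnnS.
split.
  have -> : y * (a ^+ i * b ^+ l) * p * (a * j) =
    y * (a ^+ i.+1 * b ^+ l) * (p * j) by rewrite exprS; ring.
  by apply: (IH k.+1) => //; rewrite addSn il addnS.
have -> : y * (a ^+ i * b ^+ l) * p * (b * j) =
  y * (a ^+ i * b ^+ l.+1) * (p * j) by rewrite exprS; ring.
by apply: (IH k.+1) => //; rewrite addnS il addnS.
Qed.

(** * Consequences of the PVMD and torsion hypotheses *)

Lemma span_pair_fg a b : finitely_generated R (span R [set a; b]).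
Proof. by exists [set a; b] => //; apply: finite_set2. Qed.

Lemma span_neq0 X x : X x -> x != 0 -> span R X <> [set 0].
Proof.
by move=> hx /eqP x0 E; apply: x0; have := sub_span hx; rewrite E.
Qed.

Lemma nonzero_mem H : H 0 -> H <> [set 0] -> exists2 x, H x & x != 0.
Proof.
move=> h0 hH; apply: contrapT => hn; apply: hH; apply/seteqP; split=> x /=.
  move=> hx; apply: contrapT => x0; apply: hn; exists x => //; exact/eqP.
by move=> ->.
Qed.

(** Choose [J] with [((a, b) J)_v = d R]. Each [j / d] with [j] in [J] is in the inverse of
    [(a, b)], so the condition on [z] puts [z / d] in the inverse of [(a, b) J], which is
    [d^-1 R]. *)
Lemma PVMD_v_invertible_pair a b : PVMD R -> R a -> R b -> b != 0 ->
  v_invertible_pair a b.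
Proof.
move=> hR ha hb b0 z hz; set X := [set a; b].
have hX : X `<=` R by move=> x [->|->].
have Xb : X b by right.
have [|J [[_ hJ] _ J0] [d hd E]] := hR (span R X).
  split; [exact: span_ideal|exact: span_pair_fg|exact: span_neq0 Xb b0].
have mulE x j : X x -> J j -> principal R d (x * j).
  move=> hx hj; rewrite -E; apply: sub_v_closure; apply: sub_span.
  by exists x; [exact: sub_span|exists j].
have d0 : d != 0.
  have [j hj j0] := nonzero_mem (submodule0 hJ) J0.
  have [r _ bj] := mulE b j Xb hj.
  by apply: contra_neq (mulf_neq0 b0 j0) => d0; rewrite -bj d0 mul0r.
have : ideal_inv R (principal R d) (z / d).
  rewrite -E ideal_inv_v_closure; apply/ideal_inv_mul => x j hx hj; move: x hx.
  have [||h1 h2] := hz (j / d).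
  - by rewrite mulrA; apply/principalP => //; apply: mulE => //; left.
  - by rewrite mulrA; apply/principalP => //; apply: mulE => //; right.
  suff : ideal_inv R (span R X) (z * (j / d)).
    by move=> h x /h; congr R; ring.
  by rewrite ideal_inv_span => _ [->|->]; rewrite -mulrA [_ / d * _]mulrC.
by move/ideal_inv_principal; rewrite divfK.
Qed.

(** Torsion makes some [n]-fold v-product of [(a, b)_v] principal, say [d R]; its inverse is that of
    [(a, b) ^ n], which the monomials of degree [n] generate. *)
Lemma torsion_power_principal a b : torsion_class_group R ->
  R a -> R b -> b != 0 ->
  exists n d, [/\ (0 < n)%N, d != 0 & forall y,
    R (y * d) <-> forall i l, (i + l = n)%N -> R (y * (a ^+ i * b ^+ l))].
Proof.
move=> hR ha hb b0; set X := [set a; b].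
have hX : X `<=` R by move=> x [->|->].
pose H := v_closure R (span R X).
pose c := [set vdiv_mul R H P | P in principal_fractional_ideals R].
have P1 : principal_fractional_ideals R (principal R 1).
  by exists 1 => //; apply: oner_neq0.
have [|n n0 E] := hR c.
  exists H => //; exists (span R X) => //; split.
  - split; first exact: span_submodule.
    exists 1; split; [exact: subring1|exact: oner_neq0|].
    by move=> h hh; rewrite mul1r; case: (span_ideal hX) => + _; apply.
  - exact: span_pair_fg.
  - by apply: span_neq0 b0; right.
(* [Cl_exp] only yields a coset, so a member is followed explicitly: [H1] lies in [c], and
   [powers k] is its [k]-fold product, started from [R]. *)
pose H1 := vdiv_mul R H (principal R 1).
pose powers k := iter k (vdiv_mul R H1) (principal R 1).
have powersP k : Cl_exp R c k (powers k).
  elim: k => [//|k IH]; exists H1; last by exists (powers k).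
  by exists (principal R 1).
have [d d0 dE] : principal_fractional_ideals R (powers n).
  by rewrite -E.
have invH1 y : ideal_inv R H1 y <-> R (y * a) /\ R (y * b).
  have -> : ideal_inv R H1 y <-> ideal_inv R H y.
    rewrite ideal_inv_vdiv_mul; split=> [h x hx|h x r hx [s hs <-]].
      by rewrite -[x]mulr1; apply: h => //; apply: principal_self.
    by rewrite mul1r mulrA; apply: subringM => //; apply: h.
  rewrite ideal_inv_v_closure ideal_inv_span.
  split=> [h|[h1 h2] _ [->|->] //].
  by split; apply: h; [left|right].
exists n, d; split=> // y.
rewrite -ideal_inv_principal dE => {E dE n0}.
elim: n y => [|n IH] y.
  rewrite ideal_inv_principal; split=> [h i l|/(_ 0 0)%N].
    by case: i l => [|i] [|l] // _; rewrite !expr0 mulr1.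
  by rewrite !expr0 mulr1; apply.
(* The induction hypothesis is applied to [y * x] for [x] in [H1]; then [invH1] trades all such [x]
   for the two factors [a] and [b]. *)
rewrite ideal_inv_vdiv_mul; split=> [h i l il|h x z hx hz].
  have step i' l' : (i' + l' = n)%N -> ideal_inv R H1 (y * (a ^+ i' * b ^+ l')).
    move: i' l'; suff : forall x, H1 x ->
        forall i l, (i + l = n)%N -> R (y * x * (a ^+ i * b ^+ l)).
      by move=> hx i' l' il' x /hx/(_ i' l' il'); rewrite mulrAC.
    move=> x hx; apply/IH => z hz; rewrite -mulrA; exact: h.
  case: i il => [|i].
    rewrite add0n => ->; have /invH1[_] := step 0 n erefl.
    by rewrite exprSr !mulrA.
  rewrite addSn => -[il]; have /invH1[+ _] := step i l il.
  by rewrite exprSr; congr R; ring.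
suff /IH/(_ z hz) : forall i l, (i + l = n)%N -> R (y * x * (a ^+ i * b ^+ l)).
  by rewrite mulrA.
move=> i l il; rewrite mulrAC; move: x hx; apply/invH1.
have ha' := h i.+1 l; have hb' := h i l.+1.
split; last by rewrite -!mulrA -exprSr; apply: hb'; rewrite addnS il.
have -> : y * (a ^+ i * b ^+ l) * a = y * (a ^+ i.+1 * b ^+ l).
  by rewrite exprS; ring.
by apply: ha'; rewrite addSn il.
Qed.

(** With [y = b ^- n], both [y a ^ n = x ^ n] and [y b ^ n = 1] are in [R], so the monomial
    [a b ^ (n - 1)] gives [x]. *)
Lemma PVMD_root_closed x n : PVMD R ->
  (exists a b, [/\ R a, R b, b != 0 & x = a / b]) ->
  (0 < n)%N -> R (x ^+ n) -> R x.
Proof.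
move=> hR [a [b [ha hb b0 ->]]] n0 hx.
have hab := PVMD_v_invertible_pair hR ha hb b0.
have -> : a / b = (b ^+ n)^-1 * (a ^+ 1 * b ^+ n.-1).
  rewrite -{1}(prednK n0) exprS expr1; field.
  by rewrite b0 expf_neq0.
apply: (monomials_in_subring (n := n)) => //.
- by rewrite mulrC -expr_div_n.
- by rewrite mulVf ?expf_neq0 //; exact: subring1.
- by rewrite add1n prednK.
Qed.

(** * Prime ideals and localizations *)

(** By Zorn's lemma some ideal is maximal among those containing [I] and disjoint from [S]; such an
    ideal is prime. *)
Lemma exists_prime I S : ideal R I -> S `<=` R -> S 1 ->
    (forall x y, S x -> S y -> S (x * y)) -> (forall x, I x -> ~ S x) ->
  exists P, [/\ Spec R P, I `<=` P & forall x, P x -> ~ S x].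
Proof.
move=> hI SR S1 SM IS.
(* The empty set is admitted because [Zorn_bigcup] includes the empty chain. *)
pose F := [set M : set K | M = set0 \/
  [/\ ideal R M, I `<=` M & forall x, M x -> ~ S x]].
have [|M [FM maxM]] := @Zorn_bigcup K F.
  move=> C CF Ctot.
  have [[M0 [CM0 M0n]]|hn] := pselect (exists M, C M /\ M <> set0); last first.
    left; apply/seteqP; split=> // x [M CM Mx]; apply: hn; exists M.
    by split=> // M0; rewrite M0 in Mx.
  have good M x : C M -> M x -> [/\ ideal R M, I `<=` M & forall x, M x -> ~ S x].
    by move=> CM Mx; case: (CF M CM) => // M0'; rewrite M0' in Mx.
  have [idM0 IM0 _] : [/\ ideal R M0, I `<=` M0 & forall x, M0 x -> ~ S x].
    by case: (CF M0 CM0).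
  right; split.
  - split; first by move=> x [M CM Mx]; have [[+ _] _ _] := good M x CM Mx; apply.
    split; first (apply/zmod_closedP; split).
    + by exists M0 => //; case: idM0 => _ /submodule0.
    + move=> x y [M CM Mx] [N CN Ny].
      have [MN|NM] := Ctot M N CM CN.
        exists N => //; have [[_ idN] _ _] := good N y CN Ny.
        by apply: submoduleB => //; apply: MN.
      exists M => //; have [[_ idM] _ _] := good M x CM Mx.
      by apply: submoduleB => //; apply: NM.
    + move=> r x hr [M CM Mx]; exists M => //.
      by have [[_ idM] _ _] := good M x CM Mx; apply: submoduleM.
  - by move=> x /IM0 M0x; exists M0.
  - by move=> x [M CM Mx]; have [_ _ +] := good M x CM Mx; apply.
have [idM IM MS] : [/\ ideal R M, I `<=` M & forall x, M x -> ~ S x].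
  (* The empty set is not maximal, since [I] is a nonempty member of [F]. *)
  case: FM => // M0; exfalso; apply: (maxM I); last by right; split.
  rewrite M0; split=> [x //|I0]; apply: (I0 0); case: hI => _; exact: submodule0.
have sM := idM.2.
exists M; split=> //; split=> //; first by move=> /MS.
move=> x y hx hy hxy; apply: contrapT => /not_orP[nMx nMy].
(* For [x'] outside [M], the ideal [M + R x'] is strictly larger than [M], so by maximality it meets
   [S]. *)
have meet x' : R x' -> ~ M x' -> exists m r, [/\ M m, R r & S (m + r * x')].
  move=> hx' nMx'; apply: contrapT => hn.
  pose N := [set z | exists m r, [/\ M m, R r & z = m + r * x']].
  have MN : M `<=` N.
    move=> m Mm; exists m, 0; split=> //; first exact: subring0.
    by rewrite mul0r addr0.
  apply: (maxM N); first split=> // NM.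
    apply/nMx'/NM; exists 0, 1; split; first exact: submodule0.
      exact: subring1.
    by rewrite mul1r add0r.
  right; split.
  - split.
      move=> _ [m [r [Mm hr ->]]]; apply: (submoduleD ideal_subring.2).
        by case: idM => + _; apply.
      exact: subringM.
    split; first (apply/zmod_closedP; split).
    + by apply: MN; exact: submodule0.
    + move=> _ _ [m [r [Mm hr ->]]] [m' [r' [Mm' hr' ->]]].
      exists (m - m'), (r - r'); split; [exact: submoduleB|exact: subringB|ring].
    + move=> s _ hs [m [r [Mm hr ->]]]; exists (s * m), (s * r).
      split; [exact: submoduleM|exact: subringM|ring].
  - by move=> z /IM /MN.
  - by move=> _ [m [r [Mm hr ->]]] hS; apply: hn; exists m, r.
have [m [r [Mm hr hS]]] := meet x hx nMx.
have [m' [r' [Mm' hr' hS']]] := meet y hy nMy.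
(* The product of the two elements of [S] just found lies in [M], because [x * y] does. *)
apply: MS (SM _ _ hS hS').
have -> : (m + r * x) * (m' + r' * y) =
  (m' + r' * y) * m + ((r * x) * m' + (r * r') * (x * y)) by ring.
have MR : M `<=` R by case: idM.
apply: submoduleD => //.
  apply: submoduleM => //; apply: SR; exact: hS'.
apply: submoduleD => //; apply: submoduleM => //; exact: subringM.
Qed.

(** The ideals disjoint from the multiplicative set [{1}] are the proper ones, and [b R] is
    proper. *)
Lemma nonunit_in_prime b : R b -> b != 0 -> ~ R b^-1 -> exists2 P, Spec R P & P b.
Proof.
move=> hb b0 nb.
have [|||||P [hP IP _]] := @exists_prime (principal R b) [set 1].
- exact: principal_ideal.
- by move=> _ ->; exact: subring1.
- by [].
- by move=> _ _ -> ->; rewrite /= mulr1.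
- by move=> _ [r hr <-] /= br; apply: nb; rewrite -[b^-1]mulr1 -br mulKf.
by exists P => //; apply: IP; apply: principal_self.
Qed.

Lemma prime_complementM P x y : Spec R P ->
  (R `\` P) x -> (R `\` P) y -> (R `\` P) (x * y).
Proof.
case=> _ _ hP [hx nx] [hy ny]; split; first exact: subringM.
by move/(hP _ _ hx hy) => [].
Qed.

Lemma prime_complement_neq0 P x : Spec R P -> (R `\` P) x -> x != 0.
Proof.
by case=> [[_ hP] _ _] [_ nx]; apply: contra_notN nx => /eqP->; apply: submodule0.
Qed.

Lemma localization_subring P : Spec R P ->
  GRing.subring_closed (mem (localization R P)).
Proof.
move=> hP; have [_ nP1 _] := hP; apply/subring_closedP; split.
- exists 1; first exact: subring1; exists 1; last by rewrite divr1.
  by split=> //; exact: subring1.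
- move=> _ _ [a ha [s hs <-]] [b hb [t ht <-]].
  have s0 := prime_complement_neq0 hP hs; have t0 := prime_complement_neq0 hP ht.
  exists (a * t - b * s); last exists (s * t).
  + apply: subringB; apply: subringM => //; first by case: ht.
    by case: hs.
  + exact: prime_complementM.
  + by field; rewrite s0 t0.
- move=> _ _ [a ha [s hs <-]] [b hb [t ht <-]].
  exists (a * b); first exact: subringM.
  by exists (s * t); [exact: prime_complementM|rewrite mulf_div].
Qed.

Lemma sub_localization P : Spec R P -> R `<=` localization R P.
Proof.
move=> [_ nP1 _] x hx; exists x => //; exists 1; last by rewrite divr1.
by split=> //; exact: subring1.
Qed.

End Subring.

(** * Going down overrings and global perinormality *)

Lemma Spec_setI (K : fieldType) (R B Q : set K) : R `<=` B ->
  GRing.subring_closed (mem R) -> Spec B Q -> Spec R (Q `&` R).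
Proof.
move=> RB ringR [[_ sQ] nQ1 hQ]; split; last first.
- move=> x y hx hy [hxy _].
  by have [] := hQ x y (RB _ hx) (RB _ hy) hxy; [left|right].
- by case.
split; first by move=> x [].
split; first (apply/zmod_closedP; split).
- by split; [apply: (submodule0 sQ)|apply: (subring0 ringR)].
- by move=> x y [? ?] [? ?]; split;
    [apply: (submoduleB sQ)|apply: (subringB ringR)].
- by move=> r x hr [? ?]; split;
    [apply: (submoduleM sQ) => //; apply: RB|apply: (subringM ringR)].
Qed.

Lemma going_down_coprime_unit (K : fieldType) (R B : set K) (a b x : K) :
    GRing.subring_closed (mem R) -> overring R B -> going_down R B ->
    R a -> R b -> b != 0 -> B x -> b * x = a ->
    (forall y, R (y * a) -> R (y * b) -> R y) ->
  B b^-1.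
Proof.
move=> ringR [RB ringB] gd ha hb b0 hx bx cop; apply: contrapT => nb.
have [Q hQ Qb] := nonunit_in_prime ringB (RB _ hb) b0 nb.
have hP := Spec_setI RB ringR hQ; set P := Q `&` R in hP.
have ringRP := localization_subring ringR hP.
have subRP := sub_localization ringR hP.
(* From [(a, b)_v = R] follows [(a ^ k, b)_v = R], removing one factor [a] at a time. *)
have coppow k y : R (y * a ^+ k) -> R (y * b) -> R y.
  elim: k y => [|k IH] y; first by rewrite expr0 mulr1.
  move=> h1 h2; apply: IH => //; apply: cop; first by rewrite -mulrA -exprSr.
  by rewrite mulrAC; apply: subringM => //; apply: subringX.
(* The radical argument is run by contradiction: unless some power of [a] lies in [b R_P], a prime
   [N] of [R_P] contains [b] and no power of [a]. *)
have [|||||N [hN IN Na]] := @exists_prime _ _ ringRP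
    (principal (localization R P) b) [set a ^+ k | k in [set: nat]].
- by apply: principal_ideal => //; apply: subRP.
- by move=> _ [k _ <-]; apply: subringX => //; apply: subRP.
- by exists 0%N.
- by move=> _ _ [k _ <-] [l _ <-]; exists (k + l)%N => //; rewrite exprD.
(* If [a ^ k = b (c / t)], then [(t / b) a ^ k = c] is in [R], so [t / b] is in [R] and
   [t = (t / b) b] is in [P], a contradiction. *)
- move=> _ [_ [c hc [t ht <-]] <-] [k _ E].
  have t0 := prime_complement_neq0 hP ht.
  have tE : (t / b) * b = t by rewrite divfK.
  have htb : R (t / b).
    apply: (coppow k); last by rewrite tE; case: ht.
    have -> // : t / b * a ^+ k = c by rewrite E; field; rewrite t0 b0.
  case: ht => _; apply; rewrite -tE.
  case: hP => [[_ sP] _ _]; apply: submoduleM sP _ _ => //.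
(* The prime [N'] over [N] contains [b], hence [a = b x], which forces [a] into [N]. *)
have [N' hN' E] := gd Q hQ N hN.
have [[_ sN'] _ _] := hN'.
have [N'b _] : (N' `&` localization R P) b.
  by rewrite E; apply: IN; apply: principal_self.
apply: (Na a); last by exists 1%N.
rewrite -E; split; last exact: subRP.
rewrite -bx mulrC; apply: (submoduleM sN') => //.
exact: sub_localization.
Qed.

Lemma PVMD_torsion_globally_perinormal (K : fieldType) (R : set K) :
    GRing.subring_closed (mem R) ->
    (forall x, exists a b, [/\ R a, R b, b != 0 & x = a / b]) ->
    PVMD R -> torsion_class_group R ->
  globally_perinormal R.
Proof.
move=> ringR fracR hR tors B ovB gd; have [RB ringB] := ovB.
(* All nonzero elements of [R] that become units in [B]: the largest candidate for the
   multiplicative set. *)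
exists [set s | [/\ R s, s != 0 & B s^-1]]; split.
- by move=> s [hs s0 _]; split=> //; apply/eqP.
- apply/mulr_closedP; split.
    split; [exact: subring1|exact: oner_neq0|].
    by rewrite invr1; exact: subring1.
  move=> s t [hs s0 Bs] [ht t0 Bt]; split; first exact: subringM.
    exact: mulf_neq0.
  by rewrite invfM; apply: subringM.
apply/seteqP; split=> [x hx|_ [r hr [s [_ _ hs] <-]]]; last first.
  by apply: subringM => //; apply: RB.
have [a [b [ha hb b0 xE]]] := fracR x.
have [n [d [n0 d0 dE]]] := torsion_power_principal ringR tors ha hb b0.
have hab := PVMD_v_invertible_pair ringR hR ha hb b0.
have mon : forall i l, (i + l = n)%N -> R (d^-1 * (a ^+ i * b ^+ l)).
  by apply/dE; rewrite mulVf //; exact: subring1.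
set a' := a ^+ n / d; set b' := b ^+ n / d.
have ha' : R a'.
  by have := mon n 0 (addn0 n); rewrite expr0 mulr1 mulrC.
have hb' : R b' by have := mon 0 n erefl; rewrite expr0 mul1r mulrC.
have b'0 : b' != 0 by rewrite mulf_neq0 ?invr_neq0 ?expf_neq0.
have Ex : b' * x ^+ n = a'.
  by rewrite xE /a' /b' expr_div_n; field; rewrite d0 expf_neq0.
(* Here [(a ^ n, b ^ n)_v = ((a, b) ^ n)_v] enters: [y / d] multiplies [a ^ n] and [b ^ n] into [R],
   hence all monomials of degree [n], so [(y / d) d] is in [R]. *)
have cop y : R (y * a') -> R (y * b') -> R y.
  move=> h1 h2.
  have -> : y = (y / d) * d by rewrite divfK.
  apply/dE => i l il; apply: (monomials_in_subring ringR (n := n)) => //.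
    by rewrite mulrAC -mulrA.
  by rewrite mulrAC -mulrA.
have Bb' := going_down_coprime_unit ringR ovB gd ha' hb' b'0
  (subringX ringB n hx) Ex cop.
exists (b' * x); last exists b' => //; last by rewrite mulrC mulKf.
apply: (PVMD_root_closed ringR hR (fracR _) n0).
(* [(b' x) ^ n = b' ^ (n - 1) a']. *)
rewrite exprMn -{1}(prednK n0) exprSr -mulrA Ex.
by apply: subringM => //; apply: subringX.
Qed.

(** * The quotient field of [A], and the case of GCD domains *)

Section BaseRing.
Variable A : idomainType.
Local Notation K := {fraction A}.
Local Notation R := (base_ring A).
Implicit Types (a b c g u w : A) (x y z d : K).

Lemma base_ring_subring : GRing.subring_closed (mem R).
Proof.
apply/subring_closedP; split.
- by exists 1; rewrite ?rmorph1.
- by move=> _ _ [a _ <-] [b _ <-]; exists (a - b); rewrite ?rmorphB.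
- by move=> _ _ [a _ <-] [b _ <-]; exists (a * b); rewrite ?rmorphM.
Qed.

Lemma fraction_quotient x : exists a b, b != 0 /\ x = tofrac a / tofrac b.
Proof.
elim/quotW: x => r; exists \n_r, \d_r; split; first exact: denom_ratioP.
have d0 : tofrac \d_r != 0 :> K by rewrite tofrac_eq0 denom_ratioP.
apply: (mulIf d0); rewrite divfK //; apply/eqP.
rewrite -[_ * _]/(FracField.mul _ _) !piE /FracField.equivf /FracField.mulf.
by rewrite !numden_Ratio ?mulr1 ?mul1r ?oner_eq0 ?mulf_neq0 ?denom_ratioP // mulrC.
Qed.

Lemma base_ring_fraction x :
  exists a b : K, [/\ R a, R b, b != 0 & x = a / b].
Proof.
have [a [b [b0 ->]]] := fraction_quotient x.
exists (tofrac a), (tofrac b); split=> //; [by exists a|by exists b|].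
by rewrite tofrac_eq0.
Qed.

Lemma base_ring_quotient u w : w != 0 ->
  R (tofrac u / tofrac w) <-> divides w u.
Proof.
move=> w0; have w0' : tofrac w != 0 :> K by rewrite tofrac_eq0.
split=> [[q _ qE]|[q ->]]; last by exists q; rewrite // rmorphM mulfK.
by exists q; apply/eqP; rewrite -tofrac_eq rmorphM /= qE divfK.
Qed.

(** Multiplication by [u] preserves gcds: a gcd [h] of [u a] and [u b] has the form [k u g];
    cancelling [u] shows that [k g] divides [a] and [b], hence [g], so [h] divides [u g]. *)
Lemma divides_gcdM a b g u w : GCD_domain A ->
  a != 0 -> b != 0 -> divides g a -> divides g b ->
  (forall c, divides c a -> divides c b -> divides c g) ->
  divides w (u * a) -> divides w (u * b) -> divides w (u * g).
Proof.
move=> gcdA a0 b0 ga gb gP wa wb.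
have [->|u0] := eqVneq u 0; first by exists 0; rewrite !mul0r.
have [h [ha hb hP]] := gcdA _ _ (mulf_neq0 u0 a0) (mulf_neq0 u0 b0).
have dvdM c e : divides c e -> divides (u * c) (u * e).
  by case=> q ->; exists q; rewrite mulrCA.
have [k hE] := hP _ (dvdM _ _ ga) (dvdM _ _ gb).
have kg c : divides h (u * c) -> divides (k * g) c.
  case=> q; rewrite hE => E; exists q; apply: (mulfI u0).
  by rewrite E; ring.
have [q gE] := gP _ (kg _ ha) (kg _ hb).
have [r rE] := hP _ wa wb; exists (q * r).
by rewrite -mulrA -rE hE {1}gE; ring.
Qed.

(* The equivalence alone does not rule out [d = 0] when [A] is a field. *)
Lemma GCD_inverse_pair x z : GCD_domain A ->
  exists2 d, d = 0 -> x = 0 /\ z = 0 &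
    forall y, R (y * x) /\ R (y * z) <-> R (y * d).
Proof.
move=> gcdA.
have [->|x0] := eqVneq x 0.
  exists z => // y; rewrite mulr0; split=> [[]//|]; split=> //.
  exact: subring0 base_ring_subring.
have [->|z0] := eqVneq z 0.
  exists x => // y; rewrite mulr0; split=> [[]//|]; split=> //.
  exact: subring0 base_ring_subring.
have [n1 [d1 [d10 xE]]] := fraction_quotient x.
have [n2 [d2 [d20 zE]]] := fraction_quotient z.
have n10 : n1 != 0 by apply: contra_neq x0 => n0; rewrite xE n0 rmorph0 mul0r.
have n20 : n2 != 0 by apply: contra_neq z0 => n0; rewrite zE n0 rmorph0 mul0r.
(* Over the common denominator [d1 * d2], the numerators of [x] and [z] are [n1 * d2] and
   [n2 * d1]. *)
have [g [ga gb gP]] := gcdA _ _ (mulf_neq0 n10 d20) (mulf_neq0 n20 d10).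
have d10' : tofrac d1 != 0 :> K by rewrite tofrac_eq0.
have d20' : tofrac d2 != 0 :> K by rewrite tofrac_eq0.
have g0 : tofrac g / (tofrac d1 * tofrac d2) != 0 :> K.
  rewrite mulf_neq0 ?invr_neq0 ?mulf_neq0 // tofrac_eq0.
  case: ga => q E; apply: contra_neq (mulf_neq0 n10 d20) => g0.
  by rewrite E g0 mulr0.
exists (tofrac g / (tofrac d1 * tofrac d2)) => [/eqP|y].
  by rewrite (negPf g0).
(* Absorbing the common denominator into [y] gives one fraction [u / w], so membership in [R]
   becomes divisibility by [w]. *)
have [u [w [w0 yE]]] := fraction_quotient (y / (tofrac d1 * tofrac d2)).
have quotE c v : v = tofrac c / (tofrac d1 * tofrac d2) ->
    R (y * v) <-> divides w (u * c).
  move=> ->; rewrite -base_ring_quotient // rmorphM mulrAC -yE.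
  by rewrite mulrA mulrAC.
have -> := quotE (n1 * d2) x; last by rewrite xE rmorphM -mulf_div divff // mulr1.
have -> := quotE (n2 * d1) z; last first.
  by rewrite zE rmorphM [tofrac d1 * _]mulrC -mulf_div divff // mulr1.
have -> := quotE g _ erefl; split=> [[ha hb]|[q E]].
  by apply: divides_gcdM gP ha hb => //; apply: mulf_neq0.
split.
  by case: ga => k ->; exists (k * q); rewrite mulrCA E mulrA.
by case: gb => k ->; exists (k * q); rewrite mulrCA E mulrA.
Qed.

(** [GCD_inverse_pair] adjoins the generators one by one, starting from [d = 0] for the empty
    sequence. *)
Lemma GCD_inverse_seq (s : seq K) : GCD_domain A ->
  exists2 d, d = 0 -> forall x, x \in s -> x = 0 &
    forall y, (forall x, x \in s -> R (y * x)) <-> R (y * d).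
Proof.
move=> gcdA; elim: s => [|x s [d d0 dE]].
  by exists 0 => // y; rewrite mulr0; split=> // _; exact: subring0 base_ring_subring.
have [e e0 eE] := GCD_inverse_pair x d gcdA; exists e => [/e0[x0 /d0 s0] z|y].
  by rewrite inE => /orP[/eqP->|/s0].
rewrite -eE -dE; split=> [h|[hx hs] z].
  by split=> [|z hz]; apply: h; rewrite inE ?eqxx ?hz ?orbT.
by rewrite inE => /orP[/eqP->|/hs].
Qed.

Lemma GCD_v_closure_fg (H : set K) : GCD_domain A ->
    finitely_generated R H -> H 0 -> H <> [set 0] ->
  exists d, [/\ d != 0, v_closure R H = principal R d &
    forall y, ideal_inv R H y <-> R (y * d)].
Proof.
move=> gcdA [X /finite_seqP[s ->] HE] h0 hn.
have [d d0 dE] := GCD_inverse_seq s gcdA.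
have invE y : ideal_inv R H y <-> R (y * d).
  by rewrite HE (ideal_inv_span base_ring_subring) -dE.
have {}d0 : d != 0.
  apply/eqP => /d0 s0; apply: hn; apply/seteqP; split=> [x|_ -> //].
  rewrite HE => /(_ [set 0]); apply; split; last exact: s0.
  split; first (apply/zmod_closedP; split) => //.
    by move=> _ _ -> ->; rewrite subrr.
  by move=> r _ _ -> /=; rewrite mulr0.
exists d; split=> //; apply: v_closure_principal => //.
exact: base_ring_subring.
Qed.

(** [I_v] is already principal, so [J = R], spanned by [1], works. *)
Lemma GCD_PVMD : GCD_domain A -> PVMD R.
Proof.
move=> gcdA I [[IR sI] fgI I0]; have ringR := base_ring_subring.
have R1 : [set 1 : K] `<=` R by move=> _ ->; exact: subring1.
exists (span R [set 1]).
  split; first exact: span_ideal.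
    by exists [set 1].
  by apply: (span_neq0 (x := 1)) => //; exact: oner_neq0.
have [d [d0 vE invE]] := GCD_v_closure_fg gcdA fgI (submodule0 sI) I0.
exists d.
  (* [d] is in [I_v] and [1] is in the inverse of [I], so [d * 1] is in [R]. *)
  have := principal_self ringR d; rewrite -vE => /(_ 1); rewrite mulr1; apply.
  by move=> h /IR; rewrite mul1r.
apply: v_closure_principal => // y; rewrite -invE ideal_inv_mul //.
split=> [h i hi|h i r hi hr].
  by rewrite -[i]mulr1; apply: h => //; apply: sub_span.
rewrite mulrA; apply: subringM => //; first exact: h.
by have [+ _] := span_ideal ringR R1; apply.
Qed.

Lemma vdiv_mul_principal x y : x != 0 -> y != 0 ->
  vdiv_mul R (principal R x) (principal R y) = principal R (x * y).
Proof.
move=> x0 y0; have ringR := base_ring_subring.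
apply: v_closure_principal; rewrite ?mulf_neq0 // => z.
rewrite ideal_inv_mul //; split=> [h|h _ _ [r hr <-] [s hs <-]].
  by apply: h; apply: principal_self.
have -> : z * (x * r * (y * s)) = z * (x * y) * (r * s).
  by rewrite [x * r * _]mulrACA [LHS]mulrA.
by apply: (subringM ringR); [exact: h|apply: (subringM ringR)].
Qed.

(** Every v-closure in [vdiv R] is principal, so each class is the identity and the exponent [1]
    suffices. *)
Lemma GCD_torsion : GCD_domain A -> torsion_class_group R.
Proof.
move=> gcdA c [_ [H [[sH _] fgH H0] <-] <-]; exists 1%N => //.
have [d [d0 -> _]] := GCD_v_closure_fg gcdA fgH (submodule0 sH) H0.
apply/seteqP; split.
  move=> _ [_ [_ [x x0 <-] <-] [_ [y y0 <-] <-]].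
  by rewrite !vdiv_mul_principal ?mulf_neq0 //; exists (d * x * y);
    rewrite //= !mulf_neq0.
(* [x R] is the product of [d R], which is in the class, and [(x / d) R]. *)
move=> _ [x x0 <-]; exists (principal R (d * 1)).
  exists (principal R 1); first by exists 1 => //; exact: oner_neq0.
  by rewrite vdiv_mul_principal ?oner_neq0.
exists (principal R (x / d)); first by exists (x / d) => //=; rewrite mulf_neq0 ?invr_neq0.
rewrite vdiv_mul_principal ?mulf_neq0 ?invr_neq0 ?oner_neq0 //.
by rewrite mulr1 mulrC divfK.
Qed.


End BaseRing.

Theorem theorem13 (A : idomainType) :
  (PVMD (base_ring A) -> torsion_class_group (base_ring A) ->
     globally_perinormal (base_ring A)) /\
  (GCD_domain A ->
     PVMD (base_ring A) /\ torsion_class_group (base_ring A)).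
Proof.
split; last by move=> gcdA; split; [exact: GCD_PVMD|exact: GCD_torsion].
apply: PVMD_torsion_globally_perinormal; first exact: base_ring_subring.
exact: base_ring_fraction.
Qed.
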